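(* Let $k$ be a field, let $A$ be an algebra over $k$, and let $r \in A\otimes A$ be strongly symmetric. Then $r$ is a solution of the classical Yang-Baxter equation (CYBE) in the Lie algebra $L(A)$, and $r$ is a solution of the quantum Yang-Baxter equation (QYBE) in $A$.
   Context: All tensor products are over the field $k$, and an algebra over $k$ is associative with unit $1$. Strongly symmetric: let $V$ be a $k$-vector space with basis $\{e_i \mid i\in\Omega\}$ and let $r=\sum_{i,j\in\Omega}k_{ij}(e_i\otimes e_j)\in V\otimes V$ with $k_{ij}\in k$ (finitely many nonzero). Then $r$ is called strongly symmetric (to the basis $\{e_i\}$) if $k_{ij}=k_{ji}$ and $k_{ij}k_{lm}=k_{il}k_{jm}$ for all $i,j,l,m\in\Omega$. (This property does not depend on the choice of basis.) $L(A)$ denotes the Lie algebra with underlying space $A$ and bracket $[x,y]=xy-yx$. CYBE: for a Lie algebra $L$ over $k$ and $r=\sum_i a_i\otimes b_i\in L\otimes L$, put $[r^{12},r^{13}]=\sum_{i,j}[a_i,a_j]\otimes b_i\otimes b_j$, $[r^{12},r^{23}]=\sum_{i,j}a_i\otimes[b_i,a_j]\otimes b_j$, $[r^{13},r^{23}]=\sum_{i,j}a_i\otimes a_j\otimes[b_i,b_j]$. Then $r$ is a solution of CYBE in $L$ if $[r^{12},r^{13}]+[r^{12},r^{23}]+[r^{13},r^{23}]=0$. QYBE: for $R=\sum_i a_i\otimes b_i\in A\otimes A$, put $R^{12}=\sum_i a_i\otimes b_i\otimes 1$, $R^{13}=\sum_i a_i\otimes 1\otimes b_i$, $R^{23}=\sum_i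 1\otimes a_i\otimes b_i$ in $A\otimes A\otimes A$. Then $R$ is a solution of QYBE in $A$ if $R^{12}R^{13}R^{23}=R^{23}R^{13}R^{12}$. *)

(* Defs.v *)
From HB Require Import structures.
From mathcomp Require Import all_boot all_order all_algebra sesquilinear.
From mathcomp Require Import ring_quotient finmap boolp classical_sets.
From mathcomp.multinomials Require Import freeg.

Set Implicit Arguments.
Unset Strict Implicit.
Unset Printing Implicit Defensive.

Import GRing.Theory.
Local Open Scope ring_scope.
Local Open Scope quotient_scope.

(* The tensor product V ⊗ W of vector spaces of arbitrary dimension: the free
   vector space on V * W modulo the subspace spanned by the bilinearity
   relations. *)

Section TensorRelations.
Variables (k : fieldType) (V W : lmodType k).

Definition pair_gen (v : V) (w : W) : {freeg (V * W) / k} := << (v, w) >>.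

Inductive tensor_rel : {freeg (V * W) / k} -> Prop :=
| tensor_rel0 : tensor_rel 0
| tensor_relP c x y : tensor_rel x -> tensor_rel y -> tensor_rel (c *: x + y)
| tensor_relDl v v' w :
    tensor_rel (pair_gen (v + v') w - (pair_gen v w + pair_gen v' w))
| tensor_relDr v w w' :
    tensor_rel (pair_gen v (w + w') - (pair_gen v w + pair_gen v w'))
| tensor_relZl c v w : tensor_rel (pair_gen (c *: v) w - c *: pair_gen v w)
| tensor_relZr c v w : tensor_rel (pair_gen v (c *: w) - c *: pair_gen v w).

Definition tensor_relb (x : {freeg (V * W) / k}) : bool := `[< tensor_rel x >].

Lemma tensor_relbP x : reflect (tensor_rel x) (x \in tensor_relb).
Proof. exact: asboolP. Qed.

Lemma tensor_rel_zmod_closed : zmod_closed tensor_relb.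
Proof.
split=> [|x y /tensor_relbP rx /tensor_relbP ry]; apply/tensor_relbP.
  exact: tensor_rel0.
by rewrite addrC -scaleN1r; exact: tensor_relP.
Qed.

HB.instance Definition _ :=
  GRing.isZmodClosed.Build {freeg (V * W) / k} tensor_relb
    tensor_rel_zmod_closed.

Lemma tensor_relbZ c x : x \in tensor_relb -> c *: x \in tensor_relb.
Proof.
move=> /tensor_relbP rx; apply/tensor_relbP; rewrite -[c *: x]addr0.
by apply: tensor_relP => //; exact: tensor_rel0.
Qed.

Definition tensor_ideal : zmodClosed {freeg (V * W) / k} :=
  GRing.ZmodClosed.clone _ tensor_relb _.

Definition tensor : Type := Quotient.quot tensor_ideal.

HB.instance Definition _ := Choice.on tensor.
HB.instance Definition _ := Quotient.on tensor.
HB.instance Definition _ := GRing.Zmodule.on tensor.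

Definition tpi (x : {freeg (V * W) / k}) : tensor :=
  \pi_(Quotient.quot tensor_ideal) x.

Lemma tpi_is_zmod_morphism : zmod_morphism tpi.
Proof. by move=> x y; rewrite /tpi; exact: raddfB. Qed.
HB.instance Definition _ :=
  GRing.isZmodMorphism.Build {freeg (V * W) / k} tensor tpi
    tpi_is_zmod_morphism.

Definition trepr (t : tensor) : {freeg (V * W) / k} :=
  repr (t : Quotient.quot tensor_ideal).

Lemma treprK t : tpi (trepr t) = t.
Proof. exact: (@reprK _ (Quotient.quot tensor_ideal)). Qed.

Lemma tpi_eq x y : tpi x = tpi y <-> tensor_rel (x - y).
Proof.
rewrite /tpi; split.
  by move=> /eqP; rewrite -Quotient.idealrBE => /tensor_relbP.
by move=> r; apply/eqP; rewrite -Quotient.idealrBE; apply/tensor_relbP.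
Qed.

Definition tscale (c : k) (t : tensor) : tensor := tpi (c *: trepr t).

Lemma tpiZ c x : tscale c (tpi x) = tpi (c *: x).
Proof.
apply/tpi_eq; rewrite -scalerBr; apply/tensor_relbP/tensor_relbZ/tensor_relbP.
by apply/tpi_eq; rewrite treprK.
Qed.

Lemma tscaleA a b t : tscale a (tscale b t) = tscale (a * b) t.
Proof. by rewrite -[t]treprK !tpiZ scalerA. Qed.
Lemma tscale1 : left_id 1 tscale.
Proof. by move=> t; rewrite -[t]treprK !tpiZ scale1r. Qed.
Lemma tscaleDr : right_distributive tscale +%R.
Proof.
move=> c s t; rewrite -[s]treprK -[t]treprK -raddfD !tpiZ -raddfD.
by rewrite scalerDr.
Qed.
Lemma tscaleDl t : {morph tscale^~ t : a b / a + b}.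
Proof. by move=> a b; rewrite -[t]treprK !tpiZ -raddfD scalerDl. Qed.

HB.instance Definition _ :=
  GRing.Zmodule_isLmodule.Build k tensor tscaleA tscale1 tscaleDr tscaleDl.

Lemma tpi_is_scalable : scalable tpi.
Proof. by move=> c x; rewrite -tpiZ. Qed.
HB.instance Definition _ :=
  GRing.isScalable.Build k {freeg (V * W) / k} tensor *:%R tpi tpi_is_scalable.

Definition tpure (v : V) (w : W) : tensor := tpi (pair_gen v w).

Lemma tpure_is_bilinear : bilinear_for *:%R *:%R tpure.
Proof.
have eqD x y : tensor_rel (x - y) -> tpi x = tpi y by move=> /tpi_eq.
split=> [w c v v'|v c w w'].
  rewrite /tpure (eqD _ _ (tensor_relDl _ _ _)) raddfD /=.
  by rewrite (eqD _ _ (tensor_relZl _ _ _)) linearZ.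
rewrite /tpure (eqD _ _ (tensor_relDr _ _ _)) raddfD /=.
by rewrite (eqD _ _ (tensor_relZr _ _ _)) linearZ.
Qed.

HB.instance Definition _ :=
  bilinear_isBilinear.Build k V W tensor *:%R *:%R tpure tpure_is_bilinear.

(* The map induced on V ⊗ W by f; only meaningful for bilinear f, in which case
   it is linear and does not depend on the representative (tensor_liftE). *)
Definition tensor_lift (U : lmodType k) (f : V -> W -> U) (t : tensor) : U :=
  fglift (fun p => f p.1 p.2) (trepr t).

Lemma tensorP t : exists s : seq (V * W), t = \sum_(p <- s) tpure p.1 p.2.
Proof.
exists [seq (coeff z (trepr t) *: z.1, z.2) | z <- dom (trepr t)].
rewrite big_map -[LHS]treprK -[in LHS](freeg_sumE (trepr t)) raddf_sum /=.
apply: eq_bigr => -[v w] _ /=; rewrite linearZl_LR /= /tpure -linearZ /=.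
congr tpi; apply/eqP/freeg_eqP => z.
by rewrite coeffZ !coeffU mul1r.
Qed.

Section Lift.
Variables (U : lmodType k) (f : V -> W -> U).
Hypothesis fbil : bilinear_for *:%R *:%R f.

Let g := fglift (fun p : V * W => f p.1 p.2).

Let g_linear : linear g.
Proof.
have gB : zmod_morphism g by exact: lift_is_additive.
pose gA := GRing.isZmodMorphism.Build _ _ g gB.
pose ga : {additive _ -> _} := HB.pack g gA.
have gD x y : g (x + y) = g x + g y by exact: (raddfD ga).
have gS (I : Type) (r : seq I) F : g (\sum_(i <- r) F i) = \sum_(i <- r) g (F i).
  exact: (raddf_sum ga).
have gZ c x : g (c *: x) = c *: g x.
  have -> : g x = g (\sum_(z <- dom x) << coeff z x *g z >>).
    by rewrite freeg_sumE.
  rewrite !gS scaler_sumr.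
  by apply: eq_bigr => z _; rewrite /g !liftU scalerA.
by move=> c x y; rewrite gD gZ.
Qed.

Let g_rel x : tensor_rel x -> g x = 0.
Proof.
pose gL := GRing.isLinear.Build _ _ _ _ g g_linear.
pose gl : {linear _ -> _} := HB.pack g gL.
have gU v w : gl (pair_gen v w) = f v w by rewrite /= /g liftU scale1r.
have fDl v v' w : f (v + v') w = f v w + f v' w.
  by have := fbil.1 w 1 v v'; rewrite /= !scale1r.
have fDr v w w' : f v (w + w') = f v w + f v w'.
  by have := fbil.2 v 1 w w'; rewrite /= !scale1r.
have f0l w : f 0 w = 0 by apply: (addIr (f 0 w)); rewrite -fDl !add0r.
have f0r v : f v 0 = 0 by apply: (addIr (f v 0)); rewrite -fDr !add0r.
rewrite -[g]/(gl : _ -> _); elim=> {x}.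
- exact: linear0.
- by move=> c x y _ xE _ yE; rewrite linearP xE yE scaler0 addr0.
- by move=> v v' w; rewrite linearB linearD !gU fDl subrr.
- by move=> v w w'; rewrite linearB linearD !gU fDr subrr.
- move=> c v w; rewrite linearB linearZ !gU.
  by have := fbil.1 w c v 0; rewrite /= !addr0 f0l addr0 => ->; rewrite subrr.
- move=> c v w; rewrite linearB linearZ !gU.
  by have := fbil.2 v c w 0; rewrite /= !addr0 f0r addr0 => ->; rewrite subrr.
Qed.

Let lift_tpi x : tensor_lift f (tpi x) = g x.
Proof.
apply/eqP; rewrite -subr_eq0 -[tensor_lift _ _]/(g _); apply/eqP.
have <- : g (trepr (tpi x) - x) = g (trepr (tpi x)) - g x.
  exact: lift_is_additive.
by apply/g_rel/tpi_eq; rewrite treprK.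
Qed.

Lemma tensor_liftE v w : tensor_lift f (tpure v w) = f v w.
Proof. by rewrite lift_tpi /g liftU scale1r. Qed.

Lemma tensor_lift_is_linear : linear (tensor_lift f).
Proof.
move=> c x y; rewrite -[x]treprK -[y]treprK -linearP !lift_tpi.
exact: g_linear.
Qed.

Lemma tensor_lift_sum (I : Type) (r : seq I) (v : I -> V) (w : I -> W) :
  tensor_lift f (\sum_(i <- r) tpure (v i) (w i)) = \sum_(i <- r) f (v i) (w i).
Proof.
pose lL := GRing.isLinear.Build _ _ _ _ (tensor_lift f) tensor_lift_is_linear.
pose ll : {linear _ -> _} := HB.pack (tensor_lift f) lL.
rewrite -[LHS]/(ll _) linear_sum; apply: eq_bigr => i _; exact: tensor_liftE.
Qed.

End Lift.

End TensorRelations.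

Notation "V ⊗ W" := (tensor V%type W%type) (at level 40, left associativity) : type_scope.
Notation "v ⊗ w" := (tpure v w) (at level 40, left associativity) : ring_scope.

Section BilinearTheory.
Variables (k : fieldType) (V W U : lmodType k) (f : V -> W -> U).
Hypothesis fbil : bilinear_for *:%R *:%R f.

Let lift_linear : {linear _ -> _} :=
  HB.pack (tensor_lift f)
    (GRing.isLinear.Build _ _ _ _ (tensor_lift f) (tensor_lift_is_linear fbil)).

Lemma tensor_liftD x y :
  tensor_lift f (x + y) = tensor_lift f x + tensor_lift f y.
Proof. exact: (linearD lift_linear). Qed.

Lemma tensor_liftZ c x : tensor_lift f (c *: x) = c *: tensor_lift f x.
Proof. exact: (linearZ_LR lift_linear). Qed.

End BilinearTheory.

Lemma tensor_ind (k : fieldType) (V W : lmodType k) (P : V ⊗ W -> Prop) :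
  P 0 -> (forall x y, P x -> P y -> P (x + y)) -> (forall v w, P (v ⊗ w)) ->
  forall t, P t.
Proof.
move=> P0 PD Pp t; have [s ->] := tensorP t.
by elim/big_ind: _ => // -[v w] _; exact: Pp.
Qed.

Lemma exists_functional (k : fieldType) (V : lmodType k) (u : V) :
  u != 0 -> exists2 f : V -> k^o, linear f & f u = 1.
Proof.
move=> u0.
pose Z (N : set V) := (N `|` [set 0])%classic.
pose P (N : set V) :=
  (forall c x y, N x -> N y -> N (c *: x + y)) /\ ~ N u.
have [N [[Nlin Nu] Nmax]] : exists N, P N /\ forall B, (N `<` B)%classic -> ~ P B.
  apply: Zorn_bigcup => F FP Ftot; split; last by move=> [X /FP[_ +]].
  move=> c x y [X FX Xx] [Y FY Yy].
  have [XY|YX] := Ftot _ _ FX FY.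
    by exists Y => //; apply: (FP _ FY).1 => //; exact: XY.
  by exists X => //; apply: (FP _ FX).1 => //; exact: YX.
have Zlin c x y : Z N x -> Z N y -> Z N (c *: x + y).
  have N0 z : N z -> N 0.
    by move=> Nz; have := Nlin (-1) _ _ Nz Nz; rewrite scaleN1r addNr.
  move=> [Nx|->] [Ny|->]; rewrite ?scaler0 ?add0r.
  - by left; exact: Nlin.
  - by left; apply: Nlin => //; exact: N0 Nx.
  - by left.
  - by right.
have Zu : ~ Z N u by case=> // /eqP; exact/negP.
have ZS c x : Z N x -> Z N (c *: x).
  by move=> Nx; rewrite -[c *: x]addr0; apply: Zlin => //; right.
have dec v : exists a, Z N (v - a *: u).
  pose M := [set x | exists c n, Z N n /\ x = c *: v + n]%classic.
  have NM : (N `<=` M)%classic.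
    by move=> x Nx; exists 0, x; rewrite scale0r add0r; split=> //; left.
  have [[c [n [Zn uE]]]|Mu] := pselect (M u).
    have c0 : c != 0.
      by apply/eqP => c0; apply: Zu; rewrite uE c0 scale0r add0r.
    exists c^-1; rewrite uE scalerDr scalerA mulVf // scale1r opprD addrA subrr.
    by rewrite add0r -scaleNr; exact: ZS.
  exists 0; rewrite scale0r subr0; have Mv : M v.
    by exists 1, 0; rewrite scale1r addr0; split=> //; right.
  left; apply: contrapT => Nv; apply: (Nmax M).
    by split=> //; move=> MN; exact/Nv/MN.
  split=> // c x y [a [n [Zn ->]]] [b [m [Zm ->]]].
  exists (c * a + b), (c *: n + m); split; first exact: Zlin.
  by rewrite scalerDr scalerA scalerDl addrACA.
have [f fP] := choice dec.
have uniq v a : Z N (v - a *: u) -> f v = a.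
  move=> Za; apply: contrapT => /eqP; rewrite -subr_eq0 => fa; apply: Zu.
  rewrite -[u]scale1r -(mulVf fa) -scalerA; apply: ZS.
  have := Zlin (-1) _ _ (fP v) Za.
  by rewrite scaleN1r opprB addrA subrK -scalerBl.
exists f; last by apply: uniq; rewrite scale1r subrr; right.
move=> c x y; apply: uniq.
have := Zlin c _ _ (fP x) (fP y).
by rewrite scalerBr addrACA -opprD scalerA scalerDl.
Qed.

Section TensorAlgebra.
Variables (k : fieldType) (A B : algType k).

Definition tensor_mul (s t : A ⊗ B) : A ⊗ B :=
  tensor_lift
    (fun a b => tensor_lift (fun a' b' => (a * a') ⊗ (b * b')) t) s.

Fact mul_bilinear2 a b : bilinear_for *:%R *:%R
  (fun (a' : A) (b' : B) => (a * a') ⊗ (b * b')).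
Proof.
split=> [b' c x y|a' c x y] /=.
  by rewrite mulrDr -scalerAr linearPl.
by rewrite mulrDr -scalerAr linearPr.
Qed.

Fact mul_bilinear1 t : bilinear_for *:%R *:%R
  (fun a b => tensor_lift (fun (a' : A) (b' : B) => (a * a') ⊗ (b * b')) t).
Proof.
split=> [b c x y|a c x y] /=; elim/tensor_ind: t => [|s t|a' b'].
- by rewrite -[0](scale0r 0) !(tensor_liftZ (mul_bilinear2 _ _)) !scale0r scaler0 addr0.
- rewrite !(tensor_liftD (mul_bilinear2 _ _)) => -> ->.
  by rewrite scalerDr addrACA.
- by rewrite !(tensor_liftE (mul_bilinear2 _ _)) mulrDl -scalerAl linearPl.
- by rewrite -[0](scale0r 0) !(tensor_liftZ (mul_bilinear2 _ _)) !scale0r scaler0 addr0.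
- rewrite !(tensor_liftD (mul_bilinear2 _ _)) => -> ->.
  by rewrite scalerDr addrACA.
- by rewrite !(tensor_liftE (mul_bilinear2 _ _)) mulrDl -scalerAl linearPr.
Qed.

Lemma tensor_mulE a b a' b' :
  tensor_mul (a ⊗ b) (a' ⊗ b') = (a * a') ⊗ (b * b').
Proof.
by rewrite /tensor_mul (tensor_liftE (mul_bilinear1 _)) (tensor_liftE (mul_bilinear2 _ _)).
Qed.

Lemma tensor_mulDl : left_distributive tensor_mul +%R.
Proof. by move=> x y z; exact: (tensor_liftD (mul_bilinear1 z)). Qed.

Lemma tensor_mulZl c x y : tensor_mul (c *: x) y = c *: tensor_mul x y.
Proof. exact: (tensor_liftZ (mul_bilinear1 y)). Qed.

Lemma tensor_mul0l x : tensor_mul 0 x = 0.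
Proof. by rewrite -[0 in LHS](scale0r 0) tensor_mulZl scale0r. Qed.

Lemma tensor_mulDr : right_distributive tensor_mul +%R.
Proof.
move=> x y z; elim/tensor_ind: x => [|x x' ihx ihx'|a b].
- by rewrite !tensor_mul0l addr0.
- by rewrite !tensor_mulDl ihx ihx' addrACA.
rewrite /tensor_mul !(tensor_liftE (mul_bilinear1 _)).
exact: (tensor_liftD (mul_bilinear2 _ _)).
Qed.

Lemma tensor_mulZr c x y : tensor_mul x (c *: y) = c *: tensor_mul x y.
Proof.
elim/tensor_ind: x => [|x x' ihx ihx'|a b].
- by rewrite !tensor_mul0l scaler0.
- by rewrite !tensor_mulDl ihx ihx' scalerDr.
rewrite /tensor_mul !(tensor_liftE (mul_bilinear1 _)).
exact: (tensor_liftZ (mul_bilinear2 _ _)).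
Qed.

Lemma tensor_mul0r x : tensor_mul x 0 = 0.
Proof. by rewrite -[0 in LHS](scale0r 0) tensor_mulZr scale0r. Qed.

Lemma tensor_mulA : associative tensor_mul.
Proof.
move=> x y z; elim/tensor_ind: x => [|x x' ihx ihx'|a b].
- by rewrite !tensor_mul0l.
- by rewrite !tensor_mulDl ihx ihx'.
elim/tensor_ind: y => [|y y' ihy ihy'|a' b'].
- by rewrite !(tensor_mul0l, tensor_mul0r).
- by rewrite !(tensor_mulDl, tensor_mulDr) ihy ihy'.
elim/tensor_ind: z => [|z z' ihz ihz'|a'' b''].
- by rewrite !tensor_mul0r.
- by rewrite !tensor_mulDr ihz ihz'.
by rewrite !tensor_mulE !mulrA.
Qed.

Lemma tensor_mul1l : left_id (1 ⊗ 1) tensor_mul.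
Proof.
elim/tensor_ind => [|x y ihx ihy|a b].
- exact: tensor_mul0r.
- by rewrite tensor_mulDr ihx ihy.
by rewrite tensor_mulE !mul1r.
Qed.

Lemma tensor_mul1r : right_id (1 ⊗ 1) tensor_mul.
Proof.
elim/tensor_ind => [|x y ihx ihy|a b].
- exact: tensor_mul0l.
- by rewrite tensor_mulDl ihx ihy.
by rewrite tensor_mulE !mulr1.
Qed.

Lemma tensor_1_neq0 : 1 ⊗ 1 != 0 :> A ⊗ B.
Proof.
have [f flin f1] := exists_functional (oner_neq0 A).
have fbil : bilinear_for *:%R *:%R (fun a (b : B) => f a *: b).
  split=> [b c x y|a c x y] /=.
    by rewrite flin scalerDl scalerA.
  by rewrite scalerDr !scalerA mulrC.
apply/eqP => e; have := tensor_liftE fbil 1 1; rewrite e f1 scale1r.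
rewrite -[0](scale0r 0) (tensor_liftZ fbil) scale0r => /esym/eqP.
exact/negP/oner_neq0.
Qed.

HB.instance Definition _ :=
  GRing.Zmodule_isNzRing.Build (tensor A B) tensor_mulA tensor_mul1l tensor_mul1r
    tensor_mulDl tensor_mulDr tensor_1_neq0.

HB.instance Definition _ :=
  GRing.Lmodule_isLalgebra.Build k (tensor A B)
    (fun c x y => esym (tensor_mulZl c x y)).

HB.instance Definition _ :=
  GRing.Lalgebra_isAlgebra.Build k (tensor A B)
    (fun c x y => esym (tensor_mulZr c x y)).

Lemma tensorM (a a' : A) (b b' : B) :
  (a ⊗ b) * (a' ⊗ b') = (a * a') ⊗ (b * b').
Proof. exact: tensor_mulE. Qed.

Lemma tensor1 : 1 = 1 ⊗ 1 :> A ⊗ B.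
Proof. by []. Qed.

End TensorAlgebra.

HB.mixin Record isLieAlgebra (k : fieldType) L of GRing.Lmodule k L := {
  lie : L -> L -> L;
  lie_bilinear : bilinear_for *:%R *:%R lie;
  liexx : forall x, lie x x = 0;
  lie_jacobi : forall x y z,
    lie x (lie y z) + lie y (lie z x) + lie z (lie x y) = 0
}.

#[short(type="lieAlgType")]
HB.structure Definition LieAlgebra (k : fieldType) :=
  {L of GRing.Lmodule k L & isLieAlgebra k L}.

Definition lie_of (k : fieldType) (A : algType k) : Type := A.

Section LieOf.
Variables (k : fieldType) (A : algType k).

HB.instance Definition _ := GRing.Lmodule.on (lie_of A).

Definition commutator (x y : lie_of A) : lie_of A := (x : A) * y - (y : A) * x.

Fact commutator_bilinear : bilinear_for *:%R *:%R commutator.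
Proof.
split=> [y c x x'|x c y y'];
  rewrite /commutator /= mulrDl mulrDr -scalerAl -scalerAr;
  by rewrite scalerBr opprD addrACA.
Qed.

Fact commutatorxx x : commutator x x = 0.
Proof. exact: subrr. Qed.

Fact commutator_jacobi x y z :
  commutator x (commutator y z) + commutator y (commutator z x)
  + commutator z (commutator x y) = 0.
Proof.
pose d4 (a b c d : A) : A := (a + d) - (b + c).
have E a b c : commutator a (commutator b c) =
    d4 (a * b * c) (a * c * b) (b * c * a) (c * b * a).
  rewrite /commutator /d4 mulrBl mulrBr !mulrA opprB opprD addrACA.
  by congr (_ + _); rewrite addrC.
rewrite !E /d4 [X in _ - X + _]addrC subrKA [X in _ - X + _]addrC subrKA.
by rewrite [X in X - _]addrC subrr.
Qed.

HB.instance Definition _ :=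
  isLieAlgebra.Build k (lie_of A) commutator_bilinear commutatorxx
    commutator_jacobi.

End LieOf.

(* The triple tensor power is taken to be V ⊗ (V ⊗ V). *)
Section CYBE.
Variables (k : fieldType) (L : lieAlgType k).
Implicit Types r : L ⊗ L.

(* [r^12, r^13], [r^12, r^23], [r^13, r^23], as the bilinear expressions in
   r = \sum_i a_i ⊗ b_i and r = \sum_j a_j ⊗ b_j that they stand for *)
Definition lie12_13 r : L ⊗ (L ⊗ L) :=
  tensor_lift (fun a b => tensor_lift (fun a' b' => lie a a' ⊗ (b ⊗ b')) r) r.

Definition lie12_23 r : L ⊗ (L ⊗ L) :=
  tensor_lift (fun a b => tensor_lift (fun a' b' => a ⊗ (lie b a' ⊗ b')) r) r.

Definition lie13_23 r : L ⊗ (L ⊗ L) :=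
  tensor_lift (fun a b => tensor_lift (fun a' b' => a ⊗ (a' ⊗ lie b b')) r) r.

Definition CYBE r : Prop := lie12_13 r + lie12_23 r + lie13_23 r = 0.

End CYBE.

Section LiftBilinear.
Variables (k : fieldType) (V W V' W' U : lmodType k).

Definition quadrilinear (F : V -> W -> V' -> W' -> U) : Prop :=
  [/\ forall b a' b', linear (fun a => F a b a' b'),
      forall a a' b', linear (fun b => F a b a' b'),
      forall a b b', linear (fun a' => F a b a' b') &
      forall a b a', linear (fun b' => F a b a' b')].

Lemma tensor_lift2_sum (F : V -> W -> V' -> W' -> U) (I J : Type) (r : seq I) (s : seq J)
    (a : I -> V) (b : I -> W) (a' : J -> V') (b' : J -> W') :
  quadrilinear F ->
  tensor_lift (fun x y => tensor_lift (F x y) (\sum_(j <- s) a' j ⊗ b' j))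
    (\sum_(i <- r) a i ⊗ b i) =
  \sum_(i <- r) \sum_(j <- s) F (a i) (b i) (a' j) (b' j).
Proof.
move=> [F1 F2 F3 F4].
have bil2 x y : bilinear_for *:%R *:%R (F x y).
  by split=> *; [exact: F3 | exact: F4].
rewrite tensor_lift_sum.
  by apply: eq_bigr => i _; rewrite tensor_lift_sum.
by split=> [y c x x'|x c y y'] /=; rewrite !tensor_lift_sum // scaler_sumr -big_split /=;
  apply: eq_bigr => j _; [exact: F1 | exact: F2].
Qed.

End LiftBilinear.

Section CYBETheory.
Variables (k : fieldType) (L : lieAlgType k) (I : Type) (s : seq I).
Variables a b : I -> L.
Let r := \sum_(i <- s) a i ⊗ b i.

Lemma lie12_13E : lie12_13 r =
  \sum_(i <- s) \sum_(j <- s) lie (a i) (a j) ⊗ (b i ⊗ b j).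
Proof.
apply: tensor_lift2_sum; split=> * c x y /=.
- by rewrite (lie_bilinear.1 _) linearPl.
- by rewrite linearPl linearPr.
- by rewrite (lie_bilinear.2 _) linearPl.
- by rewrite !linearPr.
Qed.

Lemma lie12_23E : lie12_23 r =
  \sum_(i <- s) \sum_(j <- s) a i ⊗ (lie (b i) (a j) ⊗ b j).
Proof.
apply: tensor_lift2_sum; split=> * c x y /=.
- by rewrite linearPl.
- by rewrite (lie_bilinear.1 _) linearPl linearPr.
- by rewrite (lie_bilinear.2 _) linearPl linearPr.
- by rewrite !linearPr.
Qed.

Lemma lie13_23E : lie13_23 r =
  \sum_(i <- s) \sum_(j <- s) a i ⊗ (a j ⊗ lie (b i) (b j)).
Proof.
apply: tensor_lift2_sum; split=> * c x y /=.
- by rewrite linearPl.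
- by rewrite (lie_bilinear.1 _) !linearPr.
- by rewrite linearPl linearPr.
- by rewrite (lie_bilinear.2 _) !linearPr.
Qed.

End CYBETheory.

Section QYBE.
Variables (k : fieldType) (A : algType k).
Implicit Types R : A ⊗ A.

Definition tensor12 R : A ⊗ (A ⊗ A) := tensor_lift (fun a b => a ⊗ (b ⊗ 1)) R.
Definition tensor13 R : A ⊗ (A ⊗ A) := tensor_lift (fun a b => a ⊗ (1 ⊗ b)) R.
Definition tensor23 R : A ⊗ (A ⊗ A) := tensor_lift (fun a b => 1 ⊗ (a ⊗ b)) R.

Definition QYBE R : Prop :=
  tensor12 R * tensor13 R * tensor23 R = tensor23 R * tensor13 R * tensor12 R.

Section Sums.
Variables (I : Type) (s : seq I) (a b : I -> A).
Let R := \sum_(i <- s) a i ⊗ b i.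

Lemma tensor12E : tensor12 R = \sum_(i <- s) a i ⊗ (b i ⊗ 1).
Proof.
apply: (@tensor_lift_sum _ _ _ _ (fun x y => x ⊗ (y ⊗ 1))).
by split=> [y c x x'|x c y y'] /=; rewrite !(linearPl, linearPr).
Qed.

Lemma tensor13E : tensor13 R = \sum_(i <- s) a i ⊗ (1 ⊗ b i).
Proof.
apply: (@tensor_lift_sum _ _ _ _ (fun x y => x ⊗ (1 ⊗ y))).
by split=> [y c x x'|x c y y'] /=; rewrite !(linearPl, linearPr).
Qed.

Lemma tensor23E : tensor23 R = \sum_(i <- s) 1 ⊗ (a i ⊗ b i).
Proof.
apply: (@tensor_lift_sum _ _ _ _ (fun x y => 1 ⊗ (x ⊗ y))).
by split=> [y c x x'|x c y y'] /=; rewrite !(linearPl, linearPr).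
Qed.

End Sums.
End QYBE.

Section StronglySymmetric.
Variables (k : fieldType) (V : lmodType k) (Omega : choiceType).
Variable e : Omega -> V.

Definition lincomb (c : {fsfun Omega -> k with 0}) : V :=
  \sum_(i <- finsupp c) c i *: e i.

Definition is_basis : Prop :=
  (forall c, lincomb c = 0 -> c = [fsfun]) /\ (forall v, exists c, v = lincomb c).

(* kk (i, j) is the coefficient k_ij of e_i ⊗ e_j *)
Definition strongly_symmetric (r : V ⊗ V) : Prop :=
  exists kk : {fsfun Omega * Omega -> k with 0},
    [/\ r = \sum_(p <- finsupp kk) kk p *: (e p.1 ⊗ e p.2),
        forall i j, kk (i, j) = kk (j, i)
      & forall i j l m, kk (i, j) * kk (l, m) = kk (i, l) * kk (j, m)].

End StronglySymmetric.

(* Main.v *)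
Require Import Defs.
From mathcomp Require Import all_boot all_algebra.
From mathcomp Require Import finmap sesquilinear.

(** Strong symmetry says that the coefficient matrix [kk] of [r] is symmetric
    of rank at most one.  If [kk (p, q) != 0], then
    [kk (p, p) * kk (q, q) = kk (p, q) ^+ 2 != 0], so the diagonal entry
    [d := kk (p, p)] does not vanish; and [kk (i, j) * d = kk (i, p) * kk (j, p)]
    then gives [r = d^-1 *: (v ⊗ v)] with [v = \sum_i kk (i, p) *: e i]
    ([strongly_symmetric_pure]).

    Both Yang-Baxter equations hold for a pure tensor [a ⊗ b] whose two factors
    commute ([CYBE_pure], [QYBE_pure]): every bracket in the classical equation
    is then zero, and the two sides of the quantum equation are
    [a ^+ 2 ⊗ (b * a ⊗ b ^+ 2)] and [a ^+ 2 ⊗ (a * b ⊗ b ^+ 2)].  The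
    factors [d^-1 *: v] and [v] do commute. *)

Import GRing.Theory.
Local Open Scope ring_scope.

Lemma CYBE_pure (k : fieldType) (L : lieAlgType k) (a b : L) :
  lie b a = 0 -> CYBE (a ⊗ b).
Proof.
move=> ba0; rewrite /CYBE.
have -> : a ⊗ b = \sum_(i <- [:: tt]) a ⊗ b by rewrite big_seq1.
rewrite lie12_13E lie12_23E lie13_23E !big_seq1 !liexx ba0.
by rewrite !(linear0l, linear0r) !addr0.
Qed.

Lemma QYBE_pure (k : fieldType) (A : algType k) (a b : A) :
  a * b = b * a -> QYBE (a ⊗ b).
Proof.
move=> abC; rewrite /QYBE.
have -> : a ⊗ b = \sum_(i <- [:: tt]) a ⊗ b by rewrite big_seq1.
rewrite tensor12E tensor13E tensor23E !big_seq1 !tensorM.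
by rewrite !(mul1r, mulr1) abC.
Qed.

(** The support of a finitely supported matrix need not be a product set; its
    sum is the double sum over the square of any finite set of indices
    that contains both projections of the support. *)
Lemma big_finsupp_square (k : fieldType) (V : lmodType k) (Omega : choiceType)
    (kk : {fsfun Omega * Omega -> k with 0}) (S : {fset Omega})
    (f : Omega * Omega -> V) :
  (forall p, p \in finsupp kk -> (p.1 \in S) && (p.2 \in S)) ->
  \sum_(p <- finsupp kk) kk p *: f p =
  \sum_(i <- S) \sum_(j <- S) kk (i, j) *: f (i, j).
Proof.
move=> suppS; rewrite -(big_allpairs (F := fun p => kk p *: f p)).
rewrite [RHS](bigID (mem (finsupp kk))) /= [X in _ + X]big1 ?addr0; last first.
  by move=> p /fsfun_dflt ->; rewrite scale0r.
rewrite -[RHS]big_filter; apply/perm_big/uniq_perm.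
- exact: fset_uniq.
- apply/filter_uniq/allpairs_uniq; rewrite ?fset_uniq //.
  by move=> [? ?] [? ?].
move=> p; rewrite mem_filter /=; case: (boolP (p \in finsupp kk)) => //=.
move=> /suppS /andP[p1 p2]; apply/esym/allpairsP.
by exists p; split=> //; case: p {p1 p2}.
Qed.

(** A symmetric matrix of rank at most one is a scalar multiple of the square
    of one of its columns, namely one through a nonzero diagonal entry. *)
Lemma strongly_symmetric_pure (k : fieldType) (V : lmodType k)
    (Omega : choiceType) (e : Omega -> V) (r : (V ⊗ V)%type) :
  strongly_symmetric e r -> exists c v, r = (c *: v) ⊗ v.
Proof.
move=> [kk [-> sym rank1]].
have [supp0|[[p q] pq]] := fset_0Vmem (finsupp kk).
  by exists 0, 0; rewrite supp0 big_nil linear0r.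
have d0 : kk (p, p) != 0.
  move: pq; rewrite mem_finsupp; apply: contra_neq => kpp0.
  by apply/eqP; rewrite -[_ == 0]orbb -mulf_eq0 rank1 kpp0 mul0r.
have kkE i j : kk (i, j) = (kk (p, p))^-1 * kk (i, p) * kk (j, p).
  by rewrite -mulrA -rank1 mulrC mulfK.
pose S : {fset Omega} := [fset x.1 | x in finsupp kk]%fset.
exists (kk (p, p))^-1, (\sum_(i <- S) kk (i, p) *: e i).
rewrite (@big_finsupp_square _ _ _ kk S (fun x => e x.1 ⊗ e x.2)).
  rewrite scaler_sumr linear_sumlz; apply: eq_bigr => i _.
  rewrite linear_sumr; apply: eq_bigr => j _ /=.
  by rewrite kkE scalerA linearZl_LR linearZr_LR /= scalerA.
(* By symmetry the projection on the second index has the same image S. *)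
move=> [i j] ij; apply/andP; split; apply/imfsetP => /=; first by exists (i, j).
by exists (j, i) => //; rewrite mem_finsupp -sym -mem_finsupp.
Qed.

Theorem theorem1p3 (k : fieldType) (A : algType k)
    (Omega : choiceType) (e : Omega -> A) (r : (A ⊗ A)%type) :
  is_basis e -> strongly_symmetric e r ->
  CYBE (r : (lie_of A ⊗ lie_of A)%type) /\ QYBE r.
Proof.
move=> _ /strongly_symmetric_pure[c [v ->]].
have cvC : c *: v * v = v * (c *: v) by rewrite -scalerAl -scalerAr.
split; last exact: QYBE_pure.
have bracket0 : v * (c *: v) - c *: v * v = 0 by rewrite cvC subrr.
exact: (@CYBE_pure k (lie_of A) (c *: v) v bracket0).
Qed.
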